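(* Let $G=K_{a_1,\ldots,a_k}$ with $k\geq 2$, and let $s$ be the number of partite sets of $G$ consisting of one vertex. Then $o(G)=\mathcal{S}$ if $s\geq 4$, or $a_i\geq 4$ for some $i\in[k]$, or $s=a_i=3$ for some $i\in[k]$, or $a_i=a_j=3$ for distinct $i,j\in[k]$; $o(G)=\mathcal{N}$ if either $s=3$ and $a_i\leq 2$ for each $i\in[k]$, or $s\leq 2$ and $a_i=3$ for exactly one $i\in[k]$; and $o(G)=\mathcal{R}$ if $\max\{s,a_i\}\leq 2$ for each $i\in[k]$. Moreover, if $o(G)=\mathcal{S}$ then $S_{\rm MB}(G)=S'_{\rm MB}(G)=2$, and if $o(G)=\mathcal{R}$ then $R_{\rm MB}(G)=R'_{\rm MB}(G)=\dim(G)$.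
   Context: $K_{a_1,\ldots,a_k}$ is the complete multipartite graph with partite sets of sizes $a_1,\ldots,a_k$; $[k]=\{1,\ldots,k\}$. A resolving set of $G$ is $W\subseteq V(G)$ such that for all distinct $x,y$ some $z\in W$ has $d(x,z)\neq d(y,z)$; $\dim(G)$ is its minimum size. In the Maker-Breaker resolving game, Resolver and Spoiler alternately select (without skipping) a not-yet-selected vertex; Resolver wins if at some point his vertices form a resolving set, otherwise Spoiler wins. R-game: Resolver moves first; S-game: Spoiler moves first. $o=\mathcal{R}$ (resp. $\mathcal{S}$) if Resolver (resp. Spoiler) has a winning strategy in both games; $o=\mathcal{N}$ if the first player has a winning strategy in each game. $R_{\rm MB}$, $R'_{\rm MB}$ are the minimum numbers of moves Resolver needs to win the R-game, resp. S-game; $S_{\rm MB}$, $S'_{\rm MB}$ the minimum numbers of moves Spoiler needs to win the R-game, resp. S-game (each $\infty$ if no winning strategy).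
   Formalization: In the second case for o(G)=N, ''a_i=3 for exactly one i'' is taken to include that all other partite sets have at most 2 vertices; otherwise K_{3,4} would fall under both the S and the N case, and its outcome is S. *)

(* Defs.v *)
From mathcomp Require Import all_boot.
From mathcomp Require Import boolp.

Set Implicit Arguments.
Unset Strict Implicit.
Unset Printing Implicit Defensive.

Section ResolvingSets.
Variables (T : finType) (e : rel T).

(* The least length of a walk from x to y. The value #|T|, never attained by a
   shortest walk, stands for the infinite distance. *)
Definition dist (x y : T) : nat :=
  find (fun n => [exists p : n.-tuple T, path e x p && (last x p == y)])
       (iota 0 #|T|).

Definition resolving (W : {set T}) : bool :=
  [forall x, forall y, (x != y) ==> [exists z in W, dist x z != dist y z]].

Definition metric_dim : nat :=
  #|[arg min_(W < [set: T] | resolving W) #|W|]|.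

End ResolvingSets.

Definition player := bool.
Definition Resolver : player := true.
Definition Spoiler : player := false.

(* The player who makes move number n (counted from 0) when p0 moves first;
   p0 = Resolver is the R-game and p0 = Spoiler is the S-game. *)
Definition mover (p0 : player) (n : nat) : player :=
  if odd n then ~~ p0 else p0.

Section Game.
Variables (T : finType) (e : rel T).

(* A strategy maps the sequence of all moves made so far, by both players and
   in order, to the next move. *)
Definition strategy := seq T -> T.

Definition legal (f : strategy) : Prop :=
  forall h, uniq h -> size h < #|T| -> f h \notin h.

Fixpoint play (p0 : player) (r s : strategy) (n : nat) : seq T :=
  if n is n'.+1 then
    let h := play p0 r s n' in
    rcons h (if mover p0 n' == Resolver then r h else s h)
  else [::].

Definition claimed (p0 p : player) (h : seq T) : {set T} :=
  [set x in h | mover p0 (index x h) == p].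

Definition resolver_wins_play (p0 : player) (r s : strategy) : Prop :=
  exists2 n, n <= #|T| & resolving e (claimed p0 Resolver (play p0 r s n)).

Definition resolver_wins (p0 : player) : Prop :=
  exists2 r, legal r & forall s, legal s -> resolver_wins_play p0 r s.

Definition spoiler_wins (p0 : player) : Prop :=
  exists2 s, legal s & forall r, legal r -> ~ resolver_wins_play p0 r s.

Definition player_wins (p0 p : player) : Prop :=
  if p == Resolver then resolver_wins p0 else spoiler_wins p0.

Inductive outcome := OutR | OutS | OutN.

Definition has_outcome (o : outcome) : Prop :=
  match o with
  | OutR => player_wins Resolver Resolver /\ player_wins Spoiler Resolver
  | OutS => player_wins Resolver Spoiler /\ player_wins Spoiler Spoiler
  | OutN => player_wins Resolver Resolver /\ player_wins Spoiler Spoiler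
  end.

Definition resolver_wins_within (p0 : player) (m : nat) : Prop :=
  exists2 r, legal r & forall s, legal s ->
    exists n, let R := claimed p0 Resolver (play p0 r s n) in
      [/\ n <= #|T|, #|R| <= m & resolving e R].

(* Spoiler has won as soon as his vertices S meet every resolving set, i.e.
   when Resolver can no longer obtain one. *)
Definition spoiler_won (S : {set T}) : Prop :=
  forall W, resolving e W -> ~~ [disjoint W & S].

Definition spoiler_wins_within (p0 : player) (m : nat) : Prop :=
  exists2 s, legal s & forall r, legal r ->
    exists n, let S := claimed p0 Spoiler (play p0 r s n) in
      [/\ n <= #|T|, #|S| <= m & spoiler_won S].

(* None stands for infinity. *)
Definition least (P : nat -> Prop) : option nat :=
  if pselect (exists m, `[< P m >]) is left exP then Some (ex_minn exP)
  else None.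

Definition R_MB : option nat := least (resolver_wins_within Resolver).
Definition R_MB' : option nat := least (resolver_wins_within Spoiler).
Definition S_MB : option nat := least (spoiler_wins_within Resolver).
Definition S_MB' : option nat := least (spoiler_wins_within Spoiler).

End Game.

Definition multipartite (k : nat) (a : 'I_k -> nat) :
    rel {i : 'I_k & 'I_(a i)} :=
  fun u v => tag u != tag v.

(* Main.v *)
Require Import Defs.
From mathcomp Require Import all_boot.
From mathcomp Require Import boolp.

(** A set resolves a complete multipartite graph exactly when it omits at most
    one vertex of each twin class, the classes being the parts with at least two
    vertices and the set of all universal vertices. Spoiler thus wins as soon as
    he owns two vertices of one class. If some class still has three free
    vertices when he is to move, two moves in that class suffice; if, possibly
    after a first move of Resolver, no class has more than two vertices not owned
    by Resolver, then Resolver wins by answering inside the class that Spoiler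
    just entered and otherwise opening a fresh class. He then never exhausts a
    class, so he makes at most dim(G) moves. *)

Set Implicit Arguments.
Unset Strict Implicit.
Unset Printing Implicit Defensive.

(** * Minimal numbers of moves and the alternation of turns *)

Lemma least_eq (P : nat -> Prop) m :
  P m -> (forall j, P j -> m <= j) -> least P = Some m.
Proof.
move=> Pm minm; rewrite /least; case: pselect => [exP|]; last first.
  by case; exists m; apply/asboolP.
case: ex_minnP => j /asboolP Pj minj; congr Some; apply/eqP.
by rewrite eqn_leq (minm _ Pj) andbT minj //; apply/asboolP.
Qed.

Lemma mover_succ (p0 : player) n : mover p0 n.+1 = ~~ mover p0 n.
Proof. by rewrite /mover /=; case: odd; case: (p0). Qed.

(** * Plays, claimed vertices, and strategies that maintain an invariant *)

Section Plays.
Variable T : finType.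
Implicit Types (h : seq T) (p : player) (f g r s : strategy T).

Lemma exists_free h : size h < #|T| -> exists x, x \notin h.
Proof.
move=> lth; apply/existsP; rewrite -negb_forall; apply/negP => /forallP hall.
have: #|T| <= size h.
  rewrite cardE; apply: uniq_leq_size; first exact: enum_uniq.
  by move=> x _; apply: hall.
by rewrite leqNgt lth.
Qed.

Lemma mem_full h x : uniq h -> size h = #|T| -> x \in h.
Proof.
move=> uh sh; apply: contraT => xh.
have /card_uniqP card_xh : uniq (x :: h) by rewrite /= xh.
by have := max_card [in x :: h]; rewrite card_xh /= sh ltnn.
Qed.

Lemma exists_legal (x0 : T) : exists f, legal f.
Proof.
exists (fun h => odflt x0 [pick x | x \notin h]) => h _ /exists_free [y yh].
by case: pickP => [//|/(_ y)]; rewrite yh.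
Qed.

Lemma size_play p0 r s n : size (play p0 r s n) = n.
Proof. by elim: n => //= n IH; rewrite size_rcons IH. Qed.

Lemma uniq_play p0 r s n :
  legal r -> legal s -> n <= #|T| -> uniq (play p0 r s n).
Proof.
move=> lr ls; elim: n => //= n IH ltn; have uh := IH (ltnW ltn).
rewrite rcons_uniq uh andbT.
by case: ifP => _; [apply: lr|apply: ls]; rewrite ?size_play.
Qed.

Lemma claimed_nil p0 p : claimed p0 p [::] = set0 :> {set T}.
Proof. by apply/setP => x; rewrite !inE. Qed.

Lemma claimed_rcons p0 p h x : x \notin h ->
  claimed p0 p (rcons h x) =
  if mover p0 (size h) == p then x |: claimed p0 p h else claimed p0 p h.
Proof.
move=> xh; apply/setP => y; case: ifP => mp;
  rewrite !inE mem_rcons inE -cats1 index_cat;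
  have [->|yx] /= := eqVneq y x; rewrite ?(negPf xh) /= ?eqxx ?addn0 ?mp //.
- by case: (y \in h).
- by case: (y \in h).
Qed.

Lemma claimed_mem p0 p h x : x \in claimed p0 p h -> x \in h.
Proof. by rewrite inE => /andP[]. Qed.

Lemma claimed_disjoint p0 h x :
  x \in claimed p0 Spoiler h -> x \notin claimed p0 Resolver h.
Proof. by rewrite !inE => /andP[-> /eqP->]. Qed.

Lemma claimed_cover p0 h x : x \in h ->
  x \notin claimed p0 Resolver h -> x \in claimed p0 Spoiler h.
Proof. by rewrite !inE => -> /=; case: mover. Qed.

Lemma claimed_play_sub p0 p r s m n : m <= n ->
  claimed p0 p (play p0 r s m) \subset claimed p0 p (play p0 r s n).
Proof.
move=> /subnKC <-; elim: (n - m) => [|d IH]; first by rewrite addn0.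
apply: subset_trans IH _; rewrite addnS /= -cats1.
apply/subsetP => x; rewrite !inE mem_cat => /andP[xh].
by rewrite index_cat xh.
Qed.

(** Player [p] always chooses a free vertex that preserves [Inv]. A play that never meets [Goal]
    then carries [Inv] to the full board, where [Goal] follows after all. Since each step may end in
    [Goal] instead, the invariant is allowed to lapse once the game is decided. *)
Lemma invariant_strategy (x0 : T) p0 p (Inv Goal : seq T -> Prop) :
    Inv [::] ->
    (forall h, uniq h -> Inv h -> mover p0 (size h) = p ->
       Goal h \/ (size h < #|T| -> exists2 x, x \notin h & Inv (rcons h x))) ->
    (forall h x, x \notin h -> Inv h -> mover p0 (size h) = ~~ p ->
       Goal h \/ Inv (rcons h x)) ->
    (forall h, uniq h -> size h = #|T| -> Inv h -> Goal h) ->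
  exists2 f, legal f & forall g, legal g -> exists2 n, n <= #|T| &
    Goal (play p0 (if p then f else g) (if p then g else f) n).
Proof.
move=> inv0 stepp stepo final; have [d ld] := exists_legal x0.
pose good h x := x \notin h /\ Inv (rcons h x).
(* The default [d] keeps [f] legal on histories where no move preserves the invariant. *)
pose f h := if pselect (exists x, good h x) is left ex
            then projT1 (cid ex) else d h.
have lf : legal f.
  move=> h uh sh.
  by rewrite /f; case: pselect => [ex|_]; [case: cid => x /= []|apply: ld].
exists f => // g lg; set pl := play _ _ _.
have upl n : n <= #|T| -> uniq (pl n) by apply: uniq_play; case: (p).
have spl n : size (pl n) = n by apply: size_play.
have [//|nogoal] := pselect (exists2 n, n <= #|T| & Goal (pl n)).
suff inv n : n <= #|T| -> Inv (pl n).
  by exists #|T| => //; apply: final; [apply: upl|apply: spl|apply: inv].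
elim: n => // n IH ltn; have uh := upl _ (ltnW ltn).
have uh' := upl _ ltn.
have ih := IH (ltnW ltn).
have ng : ~ Goal (pl n) by move=> G; apply: nogoal; exists n; rewrite // ltnW.
have plS : pl n.+1 = rcons (pl n) (if mover p0 n == p then f (pl n) else g (pl n)).
  by rewrite /pl /=; case: (p); case: (mover p0 n).
move: uh'; rewrite plS rcons_uniq => /andP[xh _].
have [mp|mp] := eqVneq (mover p0 n) p.
  have mp' : mover p0 (size (pl n)) = p by rewrite spl.
  have [//|] := stepp _ uh ih mp'; rewrite spl => /(_ ltn) [x xfree invx].
  rewrite /f; case: pselect => [ex|[]]; last by exists x.
  by case: cid => y /= [].
rewrite (negPf mp) in xh.
have mo : mover p0 (size (pl n)) = ~~ p by rewrite spl; case: mover mp; case: (p).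
by have [] := stepo _ _ xh ih mo.
Qed.

End Plays.

(** * Resolving sets and general facts on winning the game *)

Section ResolvingGame.
Variables (T : finType) (e : rel T).
Implicit Types (h : seq T) (p : player) (W S : {set T}).

Lemma resolving_sub W W' : W \subset W' -> resolving e W -> resolving e W'.
Proof.
move=> /subsetP sWW' /forallP rW; apply/forallP => x; apply/forallP => y.
apply/implyP => xy; move: (rW x) => /forallP/(_ y)/implyP/(_ xy).
by move=> /existsP[z /andP[zW dz]]; apply/existsP; exists z; rewrite sWW'.
Qed.

Lemma walk0 x y :
  [exists p : 0.-tuple T, path e x p && (last x p == y)] = (x == y).
Proof. by apply/existsP/idP => [[p]|xy]; [rewrite tuple0|exists [tuple]]. Qed.

(** A vertex [x] is at distance zero from itself and from no other vertex, so it separates itself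
    from [y], whatever the relation. Hence the minimum in [metric_dim] is taken over a nonempty
    family. *)
Lemma resolving_setT : resolving e [set: T].
Proof.
apply/forallP => x; apply/forallP => y; apply/implyP => xy.
have T0 : 0 < #|T| by apply/card_gt0P; exists x.
apply/existsP; exists x; rewrite inE /= /dist.
move: T0; case: #|T| => // m _ /=.
by rewrite !walk0 eqxx [y == x]eq_sym (negPf xy).
Qed.

Lemma metric_dim_le W : resolving e W -> metric_dim e <= #|W|.
Proof.
by rewrite /metric_dim; case: arg_minnP => [|W0 _ minW0 /minW0];
  first exact: resolving_setT.
Qed.

Lemma metric_dim_attained :
  exists2 W, resolving e W & #|W| = metric_dim e.
Proof.
rewrite /metric_dim; case: arg_minnP => [|W rW _]; first exact: resolving_setT.
by exists W.
Qed.

(** Both players' sets only grow, so they can be compared at the later of two moments: a resolving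
    set of Resolver would there be disjoint from Spoiler's set. *)
Lemma spoiler_wins_withinW p0 m :
  spoiler_wins_within e p0 m -> spoiler_wins e p0.
Proof.
case=> s ls winS; exists s => // r lr [n len rn].
have [m' [lem' _ won]] := winS r lr.
have rW : resolving e (claimed p0 Resolver (play p0 r s (maxn n m'))).
  by apply: resolving_sub rn; apply/claimed_play_sub/leq_maxl.
have /negP[] := won _ rW.
rewrite disjoint_sym disjoint_subset; apply/subsetP => x xS.
apply: (@claimed_disjoint _ p0).
by apply: (subsetP (claimed_play_sub _ _ _ _ (leq_maxr n m'))) xS.
Qed.

Lemma resolver_wins_withinW p0 m :
  resolver_wins_within e p0 m -> resolver_wins e p0.
Proof.
case=> r lr winR; exists r => // s ls.
by have [n [len _ rn]] := winR s ls; exists n.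
Qed.

Lemma not_both_win p0 : resolver_wins e p0 -> spoiler_wins e p0 -> False.
Proof. by move=> [r lr winr] [s ls wins]; apply: (wins r lr); apply: winr. Qed.

(** Resolver's final set is resolving, so no bound below the metric dimension can work; [x0]
    provides an opponent to play against. *)
Lemma resolver_wins_within_dim (x0 : T) p0 :
  resolver_wins_within e p0 (metric_dim e) ->
  least (resolver_wins_within e p0) = Some (metric_dim e).
Proof.
move=> win; apply: least_eq win _ => j [r lr winr].
have [s ls] := exists_legal x0.
by have [n [_ le_j /metric_dim_le le_d]] := winr s ls; apply: leq_trans le_j.
Qed.

End ResolvingGame.

(** * Games whose resolving sets are determined by twin classes *)

Section TwinClasses.
Variables (T : finType) (e : rel T) (x0 : T) (C : finType) (kap : T -> C).
Hypothesis resolvingP : forall W : {set T}, reflect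
  (forall x y, x != y -> kap x = kap y -> (x \in W) || (y \in W))
  (resolving e W).
Implicit Types (h : seq T) (p : player).

Definition twin_class c := [set x | kap x == c].

Lemma spoiler_won_twins (S : {set T}) x y :
  x != y -> kap x = kap y -> x \in S -> y \in S -> spoiler_won e S.
Proof.
move=> xy kxy xS yS W /resolvingP/(_ _ _ xy kxy)/orP rW.
by apply/pred0Pn; case: rW => ?; [exists x|exists y]; apply/andP.
Qed.

(** The complement of a set with at most one vertex contains a vertex of every twin pair, so it is
    resolving and avoids that set. *)
Lemma spoiler_won_card S : spoiler_won e S -> 1 < #|S|.
Proof.
move=> won; rewrite ltnNge; apply/negP => /card_le1_eqP S1.
have rW : resolving e (~: S).
  apply/resolvingP => x y xy _; rewrite !inE -negb_and.
  by apply: contra xy => /andP[xS yS]; apply/eqP/S1.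
have /negP[] := won _ rW; rewrite disjoint_subset.
by apply/subsetP => x; rewrite !inE.
Qed.

Lemma spoiler_wins_within_2 p0 :
  spoiler_wins_within e p0 2 -> least (spoiler_wins_within e p0) = Some 2.
Proof.
move=> win; apply: least_eq win _ => j [s ls wins].
have [r lr] := exists_legal x0.
by have [n [_ le_j /spoiler_won_card]] := wins r lr; move/leq_trans; apply.
Qed.

(** * Spoiler's double threat *)

Definition free_triple h := exists x y z,
  [/\ [&& x \notin h, y \notin h & z \notin h],
      [&& x != y, y != z & z != x], kap x = kap y & kap y = kap z].

(** Spoiler takes one of three free twins. Resolver's answer removes at most one of the other two,
    and Spoiler takes a remaining one. *)
Lemma free_triple_spoiler_wins p0 :
    (if p0 then forall v, free_triple [:: v] else free_triple [::]) ->
  spoiler_wins_within e p0 2.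
Proof.
move=> start.
pose S h := claimed p0 Spoiler h.
pose Goal h := #|S h| <= 2 /\ spoiler_won e (S h).
pose one_left h := exists s x,
  [/\ S h = [set s], s != x, kap s = kap x & x \notin h].
pose two_left h := exists s x y,
  [/\ S h = [set s], s \in h, [&& x != y, x \notin h & y \notin h], kap s = kap x
    & kap s = kap y].
(* The empty history stands for the R-game before Resolver's opening, after which [start] supplies
   the triple. *)
pose Inv h := if mover p0 (size h) then [\/ h = [::], two_left h | Goal h]
              else (S h = set0 /\ free_triple h) \/ one_left h.
have [||||f lf win] := @invariant_strategy T x0 p0 Spoiler Inv Goal.
- rewrite /Inv /mover /=; case: (p0) start => st; first by apply: Or31.
  by left; split=> //; apply: claimed_nil.
- move=> h uh + mS; rewrite /Inv mS /= => -[[S0 [x [y [z]]]]|[s [x [S1 sx ksx xh]]]].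
    move=> [/and3P[xh yh zh] /and3P[xy yz zx] kxy kyz].
    right=> _; exists x => //; rewrite /Inv size_rcons mover_succ mS /=.
    apply: Or32; exists x, y, z; split.
    + by rewrite /S claimed_rcons // mS eqxx -/(S h) S0 setU0.
    + by rewrite mem_rcons mem_head.
    + by rewrite !mem_rcons !inE !negb_or yz eq_sym xy yh zx zh.
    + by [].
    + by rewrite kxy.
  right=> _; exists x => //; rewrite /Inv size_rcons mover_succ mS /=.
  apply: Or33; rewrite /Goal /S claimed_rcons // mS eqxx -/(S h) S1.
  split; first by rewrite cards2 ltnS leq_b1.
  by apply: (@spoiler_won_twins _ s x); rewrite ?inE ?eqxx ?orbT.
- move=> h x xh + mR; rewrite /Inv size_rcons mover_succ mR /=.
  have SE : S (rcons h x) = S h by rewrite /S claimed_rcons // mR.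
  move=> [h0|[s [y [z [S1 sh /and3P[yz yh zh] ksy ksz]]]]|]; last by left.
    right; left; rewrite SE h0; split; first exact: claimed_nil.
    by move: mR start; rewrite h0 /mover /= => ->.
  right; right; rewrite /one_left SE.
  (* If Resolver's move hits [y], Spoiler is left with [z]; otherwise [y] itself is still free. *)
  have [yx|yx] := eqVneq y x.
    exists s, z; split=> //; first by apply: contraNneq zh => <-.
    by rewrite mem_rcons inE negb_or zh -yx eq_sym yz.
  exists s, y; split=> //; first by apply: contraNneq yh => <-.
  by rewrite mem_rcons inE negb_or yh yx.
- move=> h uh sh; have full x : x \in h by apply: mem_full.
  rewrite /Inv; case: mover.
    case=> [h0|[s [x [y [_ _]]]]|//]; first by have := full x0; rewrite h0.
    by rewrite !full andbF.
  by case=> [[_ [x [y [z []]]]]|[s [x []]]]; rewrite !full.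
by exists f => // r lr; have [n len [? ?]] := win r lr; exists n.
Qed.

Lemma free_tripleP c h :
  2 < #|twin_class c :\: [set x in h]| -> free_triple h.
Proof.
move=> /card_gt2P[x [y [z [[]]]]]; rewrite !inE.
move=> /andP[xh /eqP kx] /andP[yh /eqP ky] /andP[zh /eqP kz] [xy yz zx].
by exists x, y, z; rewrite xh yh zh xy yz zx kx ky kz.
Qed.

(** Resolver's opening [v] lowers the number of free vertices of a single class by one, so three
    free twins remain in that class or in another one. *)
Lemma spoiler_wins_second :
  (exists c, 3 < #|twin_class c|) \/
    (exists c d, [/\ c != d, 2 < #|twin_class c| & 2 < #|twin_class d|]) ->
  spoiler_wins_within e Resolver 2.
Proof.
move=> big; apply: free_triple_spoiler_wins => v.
have setE c : twin_class c :\: [set x in [:: v]] = twin_class c :\ v.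
  by apply/setP => x; rewrite !inE.
have out c : kap v != c -> twin_class c :\ v = twin_class c.
  by move=> kv; apply/setDidPl; rewrite disjoint_sym disjoints1 inE.
case: big => [[c c4]|[c [d [cd c3 d3]]]].
  apply: (@free_tripleP c); rewrite setE.
  by move: c4; rewrite (cardsD1 v); case: (v \in _) => //; apply: ltnW.
have [kv|kv] := eqVneq (kap v) c.
  by apply: (@free_tripleP d); rewrite setE out // kv.
by apply: (@free_tripleP c); rewrite setE out.
Qed.

Lemma spoiler_wins_first c :
  2 < #|twin_class c| -> spoiler_wins_within e Spoiler 2.
Proof.
move=> c3; apply/free_triple_spoiler_wins/(@free_tripleP c).
by rewrite (_ : [set x in [::]] = set0) ?setD0 //; apply/setP => x; rewrite !inE.
Qed.

(* Any class met by [R] is not exhausted by [R], while [W] omits at most one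
   vertex of each class; so [kap] embeds [R :\: W] into [kap @: (W :\: R)]. *)
Lemma unexhausted_card (R W : {set T}) : resolving e W ->
  (forall x, x \in R -> exists2 y, y \notin R & kap y = kap x) -> #|R| <= #|W|.
Proof.
move=> /resolvingP rW spare.
rewrite -(cardsID W R) -(cardsID R W) (setIC W R) leq_add2l.
have kinj : {in R :\: W &, injective kap}.
  move=> x y; rewrite !inE => /andP[xW _] /andP[yW _] kxy.
  by apply: contraNeq xW => /rW/(_ kxy); rewrite (negPf yW) orbF.
rewrite -(card_in_imset kinj); apply: leq_trans (leq_imset_card kap _).
apply/subset_leq_card/subsetP => c /imsetP[x xRW ->]; move: xRW.
rewrite inE => /andP[xW xR]; have [y yR kyx] := spare x xR.
apply/imsetP; exists y => //; rewrite inE yR /=.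
have : y != x by apply: contraNneq yR => ->.
by move=> /rW/(_ kyx); rewrite (negPf xW) orbF.
Qed.

(* When Resolver is to move, all of Spoiler's threats lie in a single class. *)
Definition resolver_safe p0 h :=
  let R := claimed p0 Resolver h in let S := claimed p0 Spoiler h in
  [/\ forall x y, x \in S -> y \in S -> kap x = kap y -> x = y,
      forall s x, s \in S -> x \notin h -> kap s = kap x ->
        if mover p0 (size h) then
          forall t y, t \in S -> y \notin h -> kap t = kap y -> kap t = kap s
        else False,
      forall x y z, [&& x != y, y != z & z != x] -> kap x = kap y ->
        kap y = kap z -> [|| x \in R, y \in R | z \in R]
    & forall x, x \in R -> exists2 y, y \notin R & kap y = kap x].

(** The twin [y] witnesses that taking [x] does not exhaust the class. As Spoiler moves next, safety
    then demands that no threat is left at all. *)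
Lemma resolver_safe_take p0 h x y :
    x \notin h -> y != x -> y \notin claimed p0 Resolver h -> kap y = kap x ->
    mover p0 (size h) = Resolver ->
    (forall t z, t \in claimed p0 Spoiler h -> z \notin rcons h x ->
       kap t <> kap z) ->
  resolver_safe p0 h -> resolver_safe p0 (rcons h x).
Proof.
move=> xh yx yR kyx mR nothreat [SS _ triple spare].
rewrite /resolver_safe size_rcons mover_succ !claimed_rcons // mR /=.
split=> // [u v w d kuv kvw|z].
  by case/or3P: (triple _ _ _ d kuv kvw) => uR; rewrite !in_setU1 uR !orbT.
have yR' : y \notin x |: claimed p0 Resolver h by rewrite in_setU1 negb_or yx.
rewrite in_setU1 => /orP[/eqP->|zR]; first by exists y.
have [w wR kwz] := spare z zR.
have [wx|wx] := eqVneq w x; first by exists y => //; rewrite kyx -wx.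
by exists w; rewrite // in_setU1 negb_or wx.
Qed.

(** Resolver blocks a threat if there is one, and otherwise takes one of two free twins. When
    neither is possible his set is already resolving, and since no class is exhausted it has at most
    [metric_dim e] vertices. *)
Lemma resolver_safe_wins p0 :
    resolver_safe p0 [::] \/ (p0 = Resolver /\ exists v, resolver_safe p0 [:: v]) ->
  resolver_wins_within e p0 (metric_dim e).
Proof.
move=> start.
pose R h := claimed p0 Resolver h; pose S h := claimed p0 Spoiler h.
pose Goal h := #|R h| <= metric_dim e /\ resolving e (R h).
pose Inv h := resolver_safe p0 h \/
  [/\ h = [::], p0 = Resolver & exists v, resolver_safe p0 [:: v]].
have goalP h : resolver_safe p0 h -> resolving e (R h) -> Goal h.
  move=> [_ _ _ spare] rR; split=> //.
  have [W rW <-] := metric_dim_attained e.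
  exact: unexhausted_card rW spare.
have [||||f lf win] := @invariant_strategy T x0 p0 Resolver Inv Goal.
- by case: start => [|[p0R exv]]; [left|right].
- move=> h uh + mR; case=> [safe|[-> _ [v safe]]]; last first.
    by right=> _; exists v => //; left.
  have [SS threats triple spare] := safe.
  have notR x : x \notin h -> x \notin R h by apply: contra; apply: claimed_mem.
  have [[s [x [sS xh ksx]]]|nothreat] :=
      pselect (exists s x, [/\ s \in S h, x \notin h & kap s = kap x]).
    right=> _; exists x => //; left.
    have neq_s z : z \notin h -> s != z.
      by apply: contraNneq => <-; apply: claimed_mem sS.
    apply: (@resolver_safe_take _ _ _ s); rewrite ?neq_s //.
      exact: claimed_disjoint.
    move=> t z tS; rewrite mem_rcons inE negb_or => /andP[zx zh] ktz.
    move: (threats _ _ sS xh ksx); rewrite mR => /(_ _ _ tS zh ktz) kts.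
    have d : [&& s != x, x != z & z != s].
      by rewrite neq_s // eq_sym zx eq_sym neq_s.
    (* A threat surviving the answer [x] would make [s], [x], [z] three twins, none of them owned by
       Resolver before this move. *)
    have := triple _ _ _ d ksx; rewrite -ksx -kts => /(_ ktz).
    by rewrite (negPf (claimed_disjoint sS)) !(negPf (notR _ _)).
  have [[x [y [xh yh xy kxy]]]|nopair] := pselect (exists x y,
      [/\ x \notin h, y \notin h, x != y & kap x = kap y]).
    right=> _; exists x => //; left.
    apply: (@resolver_safe_take _ _ _ y); rewrite ?notR 1?eq_sym //.
    move=> t z tS; rewrite mem_rcons inE negb_or => /andP[_ zh] ktz.
    by apply: nothreat; exists t, z.
  (* A twin pair missed by Resolver would be owned by Spoiler, or be a threat, or be a free pair,
     and all three are excluded. *)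
  left; apply: goalP => //; apply/resolvingP => x y xy kxy.
  rewrite -[_ || _]negbK negb_or; apply/negP => /andP[xR yR].
  have [xh|xh] := boolP (x \in h); have [yh|yh] := boolP (y \in h).
  + by case/eqP: xy; apply: SS; rewrite // claimed_cover.
  + by apply: nothreat; exists x, y; rewrite /S claimed_cover.
  + by apply: nothreat; exists y, x; rewrite /S claimed_cover.
  + by apply: nopair; exists x, y.
- move=> h x xh + mS; case=> [[SS threats triple spare]|[h0 p0R _]]; last first.
    by move: mS; rewrite h0 p0R.
  right; left; rewrite /resolver_safe size_rcons mover_succ !claimed_rcons // mS /=.
  rewrite mS in threats.
  split=> // [u v|s z].
    rewrite !in_setU1 => /orP[/eqP->|uS] /orP[/eqP->|vS] // kuv; last exact: SS.
      by case: (threats _ _ vS xh).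
    by case: (threats _ _ uS xh).
  (* There was no threat before Spoiler's move, so every new one comes from [x] and lies in its
     class. *)
  have isx t w : t \in x |: claimed p0 Spoiler h -> w \notin rcons h x ->
      kap t = kap w -> t = x.
    rewrite in_setU1 mem_rcons inE negb_or => /orP[/eqP->//|tS] /andP[_ wh] ktw.
    by case: (threats _ _ tS wh).
  by move=> sS zh /(isx _ _ sS zh)-> t w tS wh /(isx _ _ tS wh)->.
- move=> h uh sh; have full x : x \in h by apply: mem_full.
  case=> [safe|[h0 _ _]]; last by have := full x0; rewrite h0.
  apply: goalP => //; apply/resolvingP => x y xy kxy.
  rewrite -[_ || _]negbK negb_or; apply/negP => /andP[xR yR].
  by have [SS _ _ _] := safe; case/eqP: xy; apply: SS; rewrite // claimed_cover.
by exists f => // s ls; have [n len [? ?]] := win s ls; exists n.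
Qed.

Lemma resolver_wins_small p0 : (forall c, #|twin_class c| <= 2) ->
  resolver_wins_within e p0 (metric_dim e).
Proof.
move=> small; apply: resolver_safe_wins; left.
rewrite /resolver_safe !claimed_nil.
split=> [x y|s x|x y z /and3P[xy yz zx] kxy kyz|x]; rewrite ?inE //.
have := small (kap z); rewrite leqNgt => /card_gt2P[].
by exists x, y, z; rewrite !inE kxy kyz eqxx.
Qed.

(** Opening with a vertex [v] of the class of three leaves two others there, so every class has at
    most two vertices not owned by Resolver. *)
Lemma resolver_wins_first c : #|twin_class c| = 3 ->
  (forall d, d != c -> #|twin_class d| <= 2) ->
  resolver_wins_within e Resolver (metric_dim e).
Proof.
move=> c3 small; apply: resolver_safe_wins; right; split=> //.
have /card_gt2P[v [w [_ [[+ + _] [vw _ _]]]]] : 2 < #|twin_class c| by rewrite c3.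
rewrite !inE => /eqP kv /eqP kw; exists v.
have SE : claimed Resolver Spoiler [:: v] = set0.
  by rewrite -[[:: v]]/(rcons [::] v) claimed_rcons //= claimed_nil.
have RE : claimed Resolver Resolver [:: v] = [set v].
  by rewrite -[[:: v]]/(rcons [::] v) claimed_rcons //= claimed_nil setU0.
rewrite /resolver_safe SE RE.
split=> [x y|s x|x y z /and3P[xy yz zx] kxy kyz|x]; rewrite ?inE //; last first.
  by move=> /eqP->; exists w; rewrite ?inE 1?eq_sym // kv.
have [kz|kz] := eqVneq (kap z) c; last first.
  have := small _ kz; rewrite leqNgt => /card_gt2P[].
  by exists x, y, z; rewrite !inE kxy kyz eqxx.
rewrite -[X in is_true X]negbK !negb_or; apply/negP => /and3P[xv yv zv].
have : 2 < #|twin_class c :\ v|.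
  apply/card_gt2P; exists x, y, z; rewrite !inE xv yv zv kxy kyz kz eqxx.
  by split.
by move: c3; rewrite (cardsD1 v) inE kv eqxx add1n => -[->].
Qed.

(** * Class sizes recovered from the outcome *)

Lemma outcome_S_within_2 : has_outcome e OutS ->
  spoiler_wins_within e Resolver 2 /\ spoiler_wins_within e Spoiler 2.
Proof.
case=> winR _.
(* If no class has four vertices and no two classes have three, Resolver wins the R-game, against
   the assumed outcome. *)
have [big|notbig] := pselect ((exists c, 3 < #|twin_class c|) \/
    exists c d, [/\ c != d, 2 < #|twin_class c| & 2 < #|twin_class d|]).
  split; first exact: spoiler_wins_second.
  case: big => [[c /ltnW c3]|[c [_ [_ c3 _]]]]; exact: spoiler_wins_first c3.
have noR : ~ resolver_wins_within e Resolver (metric_dim e).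
  by move=> /resolver_wins_withinW /not_both_win; apply.
have [[c c3]|no3] := pselect (exists c, 2 < #|twin_class c|); case: noR.
  apply: (@resolver_wins_first c) => [|d dc].
    apply/eqP; rewrite eqn_leq c3 andbT leqNgt.
    by apply/negP => c4; apply: notbig; left; exists c.
  rewrite leqNgt; apply/negP => d3; apply: notbig; right.
  by exists d, c.
apply: resolver_wins_small => c; rewrite leqNgt.
by apply/negP => c3; apply: no3; exists c.
Qed.

Lemma outcome_R_small : has_outcome e OutR -> forall c, #|twin_class c| <= 2.
Proof.
case=> _ winS c; rewrite leqNgt; apply/negP => /spoiler_wins_first.
by move/spoiler_wins_withinW; apply: not_both_win.
Qed.

End TwinClasses.

(** * Complete multipartite graphs *)

Section Multipartite.
Variables (k : nat) (a : 'I_k -> nat).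
Hypotheses (hk : 2 <= k) (ha : forall i, 0 < a i).
Let V : finType := {i : 'I_k & 'I_(a i)}.
Implicit Types x y z : V.
Let G : rel V := multipartite (a := a).

Definition part_vertex i : V := Tagged (fun j => 'I_(a j)) (Ordinal (ha i)).

Lemma other_part (i : 'I_k) : exists j : 'I_k, j != i.
Proof.
have : 1 < #|'I_k| by rewrite card_ord.
case/card_gt1P => u [v [_ _ uv]]; have [<-|ui] := eqVneq u i.
  by exists v; rewrite eq_sym.
by exists u.
Qed.

Lemma multipartite_dist x y :
  dist G x y = if x == y then 0 else if tag x == tag y then 2 else 1.
Proof.
have walk1 : [exists p : 1.-tuple V, path G x p && (last x p == y)] =
    (tag x != tag y).
  apply/existsP/idP => [[p]|xy]; last first.
    by exists [tuple y]; rewrite /= eqxx !andbT.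
  by case/tupleP: p => z p; rewrite tuple0 /= andbT => /andP[+ /eqP<-].
rewrite /dist; have V0 : 0 < #|V| by apply/card_gt0P; exists x.
have [xy|xy] := eqVneq x y.
  by move: V0; case: #|V| => //= n _; rewrite walk0 xy eqxx.
have [j jx] := other_part (tag x); pose w := part_vertex j.
have wx : tag w != tag x by [].
have [txy|txy] := eqVneq (tag x) (tag y); last first.
  have : 1 < #|V| by apply/card_gt1P; exists x, y.
  by case: #|V| => [|[|n]] //= _; rewrite walk0 walk1 txy (negPf xy).
have walk2 : [exists p : 2.-tuple V, path G x p && (last x p == y)].
  by apply/existsP; exists [tuple w; y];
     rewrite /= /G /multipartite -txy wx eq_sym wx eqxx.
(* The search in [dist] runs below [#|V|], so three distinct vertices are needed for it to reach
   length 2. *)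
have : 2 < #|V|.
  apply/card_gt2P; exists x, y, w; split=> //; split=> //.
    by apply: contraNneq wx => <-; rewrite txy.
  by apply: contraNneq wx => ->.
by case: #|V| => [|[|[|n]]] //= _; rewrite walk0 walk1 walk2 txy eqxx (negPf xy).
Qed.

(* The universal vertices form one class of true twins, [None]; every part with
   at least two vertices is a class of false twins. *)
Definition twin_id x : option 'I_k := if a (tag x) == 1 then None else Some (tag x).

Lemma universal_part x z : a (tag x) == 1 -> x != z -> tag x != tag z.
Proof.
case: x z => i u [j v] /= ai; apply: contra => /eqP ij; case: _ / ij v => v.
rewrite eq_Tagged /=; apply/eqP/val_inj.
have lt0 (w : 'I_(a i)) : val w = 0 by case: w => /= m; rewrite (eqP ai); case: m.
by rewrite !lt0.
Qed.

(** Twins have equal distances to every third vertex, so only they separate each other. Conversely,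
    if [x] and [y] lie outside [W] and are not twins, one of them has a twin in its part; this twin
    must be in [W], at distance 2 from one and 1 from the other. *)
Lemma multipartite_resolvingP (W : {set V}) : reflect
  (forall x y, x != y -> twin_id x = twin_id y -> (x \in W) || (y \in W))
  (resolving G W).
Proof.
apply: (iffP forallP) => [rW x y xy kxy|cov x].
  move: (rW x) => /forallP/(_ y)/implyP/(_ xy)/existsP[z /andP[zW]].
  apply: contraR; rewrite negb_or => /andP[xW yW].
  have zx : x != z by apply: contraNneq xW => ->.
  have zy : y != z by apply: contraNneq yW => ->.
  rewrite !multipartite_dist (negPf zx) (negPf zy).
  move: kxy; rewrite /twin_id; case: ifP => ax; case: ifP => ay //;
    last by case=> ->; rewrite eqxx.
  by rewrite (negPf (universal_part ax zx)) (negPf (universal_part ay zy)).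
apply/forallP => y; apply/implyP => xy; apply/existsP.
have [xW|xW] := boolP (x \in W).
  exists x; rewrite xW !multipartite_dist eqxx eq_sym [y == x]eq_sym (negPf xy).
  by case: ifP.
have [yW|yW] := boolP (y \in W).
  exists y; rewrite yW !multipartite_dist eqxx (negPf xy).
  by case: ifP.
have kxy : twin_id x != twin_id y.
  by apply/eqP => /(cov _ _ xy); rewrite (negPf xW) (negPf yW).
(* Two universal vertices would be twins, so one of the two lies in a part with at least two
   vertices. *)
wlog ax : x y xy xW yW kxy / a (tag x) != 1.
  move=> wl; have [ax|ax] := boolP (a (tag x) != 1); first exact: wl.
  have ay : a (tag y) != 1 by move: kxy; rewrite /twin_id (negPn ax); case: ifP.
  have yx : y != x by rewrite eq_sym.
  have kyx : twin_id y != twin_id x by rewrite eq_sym.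
  have [z /andP[zW dz]] := wl y x yx yW xW kyx ay.
  by exists z; rewrite zW eq_sym.
have : 1 < #|'I_(a (tag x))|.
  by rewrite card_ord ltn_neqAle eq_sym ax ha.
case/card_gt1P=> u [v [_ _ uv]].
have [z zx tzx] : exists2 z, z != x & tag z = tag x.
  have [ux|ux] := eqVneq (Tagged (fun j => 'I_(a j)) u) x;
    last by exists (Tagged (fun j => 'I_(a j)) u).
  exists (Tagged (fun j => 'I_(a j)) v) => //.
  apply: contraNneq uv => vx.
  by have /eqP := etrans ux (esym vx); rewrite eq_Tagged.
have kzx : twin_id z = twin_id x by rewrite /twin_id tzx.
have zW : z \in W by have := cov _ _ zx kzx; rewrite (negPf xW) orbF.
have txy : tag x != tag y.
  by apply: contraNneq kxy => txy; rewrite /twin_id txy.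
exists z; rewrite zW !multipartite_dist tzx eqxx [x == z]eq_sym (negPf zx).
by rewrite [tag y == _]eq_sym (negPf txy); case: ifP.
Qed.

Lemma card_class_None : #|twin_class twin_id None| = #|[set i | a i == 1]|.
Proof.
have tinj : {in twin_class twin_id None &, injective (fun x : V => tag x)}.
  move=> x y; rewrite inE /twin_id; case: ifP => // ax _ _ txy.
  apply/eqP; apply: contraT => /(universal_part ax).
  by rewrite txy eqxx.
rewrite -(card_in_imset tinj); congr #|pred_of_set _|; apply/setP => i.
rewrite inE; apply/imsetP/idP => [[x + ->]|ai].
  by rewrite inE /twin_id; case: ifP.
by exists (part_vertex i); rewrite // inE /twin_id /= ai.
Qed.

Lemma card_class_Some i : a i != 1 -> #|twin_class twin_id (Some i)| = a i.
Proof.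
move=> ai; rewrite -[RHS]card_ord.
have tinj : injective (fun u : 'I_(a i) => Tagged (fun j => 'I_(a j)) u : V).
  by move=> u v /eqP; rewrite eq_Tagged => /eqP.
rewrite -(card_imset _ tinj); congr #|pred_of_set _|; apply/setP => x.
rewrite inE; apply/eqP/imsetP => [|[u _ ->]].
  rewrite /twin_id; case: ifP => // _ []; case: x => j u /= ji.
  by case: _ / ji {ai tinj} => /=; exists u.
by rewrite /twin_id /= (negPf ai).
Qed.

(** The vertex of a singleton part is labelled [None], so the label [Some i] names an empty
    class. *)
Lemma card_class_Some1 i : a i == 1 -> #|twin_class twin_id (Some i)| = 0.
Proof.
move=> ai; apply: eq_card0 => x; rewrite !inE /twin_id.
by case: ifP => // ax; apply: contraFF ax => /eqP[->].
Qed.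

End Multipartite.

(** * Outcomes and move numbers read off from the part sizes *)

Theorem theorem4p12 (k : nat) (a : 'I_k -> nat)
    (hk : 2 <= k) (ha : forall i, 0 < a i) :
  let G := multipartite (a := a) in
  let s := #|[set i | a i == 1]| in
  [/\ [\/ 4 <= s,
          exists i, 4 <= a i,
          exists i, s = 3 /\ a i = 3
        | exists i j, [/\ i <> j, a i = 3 & a j = 3]] ->
        has_outcome G OutS,
      (s = 3 /\ (forall i, a i <= 2)) \/
      (s <= 2 /\ (exists i, a i = 3 /\ (forall j, j <> i -> a j <= 2))) ->
        has_outcome G OutN,
      (forall i, maxn s (a i) <= 2) -> has_outcome G OutR,
      has_outcome G OutS -> S_MB G = Some 2 /\ S_MB' G = Some 2
    & has_outcome G OutR ->
        R_MB G = Some (metric_dim G) /\ R_MB' G = Some (metric_dim G)].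
Proof.
move=> G s; pose x0 := part_vertex ha (Ordinal (ltnW hk)).
have resP := multipartite_resolvingP hk ha.
have cN : #|twin_class (@twin_id k a) None| = s by apply: card_class_None.
have cS i : a i != 1 -> #|twin_class (@twin_id k a) (Some i)| = a i.
  exact: card_class_Some.
have cle i : #|twin_class (@twin_id k a) (Some i)| <= a i.
  have [a1|a1] := boolP (a i == 1); first by rewrite card_class_Some1.
  by rewrite cS.
split.
- move=> big.
  (* The four conditions on [s] and [a] amount to one class of at least four vertices or two classes
     of at least three, where [None] is the class of size [s]. *)
  suff H : (exists c, 3 < #|twin_class (@twin_id k a) c|) \/ exists c d,
      [/\ c != d, 2 < #|twin_class (@twin_id k a) c| & 2 < #|twin_class (@twin_id k a) d|].
    split; apply: spoiler_wins_withinW.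
      exact: (spoiler_wins_second x0 resP H).
    have [c c3] : exists c, 2 < #|twin_class (@twin_id k a) c|.
      by case: H => [[c /ltnW c3]|[c [_ [_ c3 _]]]]; exists c.
    exact: (spoiler_wins_first x0 resP c3).
  case: big => [s4|[i i4]|[i [s3 i3]]|[i [j [/eqP ij i3 j3]]]].
  + by left; exists None; rewrite cN.
  + by left; exists (Some i); rewrite cS //; case: (a i) i4 => [|[]].
  + by right; exists None, (Some i); rewrite cN cS ?i3 ?s3.
  + by right; exists (Some i), (Some j); rewrite !cS ?i3 ?j3.
- move=> one.
  suff [c c3 small] : exists2 c, #|twin_class (@twin_id k a) c| = 3 &
      forall d, d != c -> #|twin_class (@twin_id k a) d| <= 2.
    split; first exact: resolver_wins_withinW (resolver_wins_first x0 resP c3 small).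
    apply: spoiler_wins_withinW (spoiler_wins_first x0 resP (c := c) _).
    by rewrite c3.
  case: one => [[s3 a2]|[s2 [i [i3 a2]]]].
    by exists None => [|[i|//] _]; rewrite ?cN //; apply: leq_trans (cle i) _.
  exists (Some i) => [|[j|] ji]; [by rewrite cS ?i3| |by rewrite cN].
  by apply: leq_trans (cle j) _; apply: a2 => ij; rewrite ij eqxx in ji.
- move=> small.
  have small' c : #|twin_class (@twin_id k a) c| <= 2.
    case: c => [i|].
      apply: leq_trans (cle i) _.
      by move: (small i); rewrite geq_max => /andP[].
    by rewrite cN; move: (small (Ordinal (ltnW hk))); rewrite geq_max => /andP[].
  by split; apply: resolver_wins_withinW (resolver_wins_small x0 resP _ small').
- move=> /(outcome_S_within_2 x0 resP)[wR wS].
  by split; apply: spoiler_wins_within_2 resP _ _.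
move=> /(outcome_R_small x0 resP) small.
by split; apply: resolver_wins_within_dim => //; apply: resolver_wins_small resP _ small.
Qed.
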